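(* Let $n\ge 1$ and let $d\in\mathbb{R}$ with $d<n/2$. Let $a\in(0,\infty)$ and let $F$ be admissible on $I=[0,a)$ with $F\in C^2((0,a))$ and $F'>0$ in $(0,a)$. Set $\kappa_F^*:=\limsup_{r\to\infty}\kappa_F(r)$. (1) If $\kappa_F^*<1/2$, then $U_d[\phi]$ possesses the eventual $F$-concavity property for all $\phi\in\mathcal{L}$. (2) If $\kappa_F^*>1/2$, then $U_d[\phi]$ does not possess the eventual $F$-concavity property for any $\phi\in\mathcal{L}$.
   Context: $\mathcal{L}$ is the set of nontrivial (not a.e. zero), nonnegative, bounded measurable functions on $\mathbb{R}^n$ with compact support. For $\phi\in\mathcal{L}$, $(e^{t\Delta}\phi)(x):=(4\pi t)^{-n/2}\int_{\mathbb{R}^n}e^{-|x-y|^2/(4t)}\phi(y)\,dy$ and $U_d[\phi](x,t):=(4\pi t)^d(e^{t\Delta}\phi)(x)$ for $(x,t)\in\mathbb{R}^n\times(0,\infty)$. A function $F:I=[0,a)\to[-\infty,\infty)$ is admissible on $I$ if $F$ is continuous on $(0,a)$, strictly increasing on $I$, and $F(0)=-\infty$. $\mathcal{A}(I)$ is the set of $I$-valued functions on $\mathbb{R}^n$. $f\in\mathcal{A}(I)$ is $F$-concave in $\mathbb{R}^n$ if $F(f((1-\mu)x+\mu y))\ge(1-\mu)F(f(x))+\mu F(f(y))$ for all $x,y\in\mathbb{R}^n$, $\mu\in(0,1)$. $U_d[\phi]$ possesses the eventual $F$-concavity property if there exists $T>0$ such that $U_d[\phi](\cdot,t)$ is ($I$-valued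 and) $F$-concave in $\mathbb{R}^n$ for all $t\in[T,\infty)$. $\mathcal{F}(r):=F(ae^{-r})$ and $\kappa_F(r):=-r\,\mathcal{F}''(r)/\mathcal{F}'(r)$ for $r\in(0,\infty)$. *)

(* Defs.v *)
From HB Require Import structures.
From mathcomp Require Import all_boot all_order all_algebra.
From mathcomp Require Import all_classical all_reals all_analysis.

Set Implicit Arguments.
Unset Strict Implicit.
Unset Printing Implicit Defensive.
Import Order.TTheory GRing.Theory Num.Theory.
Import numFieldNormedType.Exports.

Local Open Scope ring_scope.
Local Open Scope classical_set_scope.

(* R^n is ['rV[R]_n], with the library's topology (the product topology) and
   the sigma-algebra generated by the coordinates, which is the Borel
   sigma-algebra of R^n. *)
Section measurable_rV.
Context {R : realType} (n : nat).

Let coord (i : 'I_n) (x : 'rV[R]_n) : R := x ord0 i.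

Let rV_set0 : g_sigma_preimage coord set0.
Proof. exact: sigma_algebra0. Qed.

Let rV_setC A : g_sigma_preimage coord A -> g_sigma_preimage coord (~` A).
Proof. exact: sigma_algebraC. Qed.

Let rV_bigcup (F : _^nat) : (forall i, g_sigma_preimage coord (F i)) ->
  g_sigma_preimage coord (\bigcup_i (F i)).
Proof. exact: sigma_algebra_bigcup. Qed.

HB.instance Definition _ :=
  @isMeasurable.Build (measure_tuple_display default_measure_display)
    'rV[R]_n (g_sigma_preimage coord) rV_set0 rV_setC rV_bigcup.

Lemma measurable_coord (i : 'I_n) :
  measurable_fun [set: 'rV[R]_n] (fun x : 'rV[R]_n => x ord0 i).
Proof.
move=> _ Y mY; rewrite setTI; apply: sub_sigma_algebra => /=.
rewrite -bigcup_seq/=; exists i => /=; first by rewrite mem_index_enum.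
by exists Y => //; rewrite setTI.
Qed.

Lemma measurable_fun_rV d (T : measurableType d) (f : T -> 'rV[R]_n) :
  (forall i, measurable_fun setT (fun t => f t ord0 i)) ->
  measurable_fun setT f.
Proof.
move=> mf _ A mA.
suff pf : g_sigma_preimage (fun i => coord i \o f) `<=` measurable.
  by apply: pf; rewrite g_sigma_preimage_comp; exists A.
apply: smallest_sub; first exact: sigma_algebra_measurable.
move=> B; rewrite -bigcup_seq => -[i _ [C mC <-]].
exact: mf.
Qed.

End measurable_rV.

Section lebesgue_measure_rV.
Context {R : realType}.
Local Open Scope ereal_scope.

Definition cons_rV n (p : R * 'rV[R]_n) : 'rV[R]_n.+1 :=
  row_mx (const_mx p.1 : 'rV[R]_1) p.2.

Fixpoint borel_lebesgue_rV (n : nat) : set 'rV[R]_n -> \bar R :=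
  match n with
  | 0 => \d_(0%R : 'rV[R]_0)
  | m.+1 => pushforward (@lebesgue_measure R \x @borel_lebesgue_rV m)
                        (@cons_rV m)
  end.
Arguments borel_lebesgue_rV n A : clear implicits.

Definition box n (a b : 'rV[R]_n) : set 'rV[R]_n :=
  [set x | forall i, x ord0 i \in `[a ord0 i, b ord0 i]%R].

Lemma measurable_box n (a b : 'rV[R]_n) : measurable (box a b).
Proof.
rewrite (_ : box a b = \bigcap_(i in [set: 'I_n])
  ((fun x : 'rV[R]_n => x ord0 i) @^-1` `[a ord0 i, b ord0 i]%classic)).
  apply: fin_bigcap_measurable => // i _; rewrite -[X in measurable X]setTI.
  by apply: measurable_coord => //; exact: measurable_itv.
by apply/seteqP; split => [x xab i _|x xab i]; have := xab i; [exact|exact].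
Qed.

Lemma cons_rV0 n (p : R * 'rV[R]_n) : cons_rV p ord0 ord0 = p.1.
Proof.
transitivity (row_mx (const_mx p.1 : 'rV[R]_1) p.2 ord0 (lshift n ord0)).
  by congr (row_mx _ _ _ _); exact/val_inj.
by rewrite row_mxEl mxE.
Qed.

Lemma cons_rVS n (p : R * 'rV[R]_n) (i : 'I_n) :
  cons_rV p ord0 (lift ord0 i) = p.2 ord0 i.
Proof.
transitivity (row_mx (const_mx p.1 : 'rV[R]_1) p.2 ord0 (rshift 1 i)).
  by congr (row_mx _ _ _ _); exact/val_inj.
by rewrite row_mxEr.
Qed.

Lemma measurable_cons_rV n : measurable_fun setT (@cons_rV n).
Proof.
apply: measurable_fun_rV => i; case: (unliftP ord0 i) => [j ->|->].
  under eq_fun do rewrite cons_rVS.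
  exact: (measurableT_comp (measurable_coord j)).
by under eq_fun do rewrite cons_rV0; exact: measurable_fst.
Qed.

Lemma sigma_finite_box n (m : {measure set 'rV[R]_n -> \bar R}) :
  (forall a b : 'rV[R]_n, (forall i, a ord0 i <= b ord0 i)%R ->
    m (box a b) = (\prod_(i < n) (b ord0 i - a ord0 i))%:E) ->
  sigma_finite setT m.
Proof.
move=> mE; exists (fun k => box (const_mx (- k%:R)%R) (const_mx k%:R%R)).
  apply/seteqP; split => // x _.
  exists (Num.truncn (\sum_(i < n) `|x ord0 i|)%R).+1 => // i.
  rewrite !mxE in_itv /= -ler_norml.
  apply: le_trans (ltW (truncnS_gt _)).
  by rewrite (bigD1 i)//= lerDl sumr_ge0.
move=> k; split; first exact: measurable_box.
rewrite mE ?ltry// => i; rewrite !mxE.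
by apply: (@le_trans _ _ 0%R); rewrite ?oppr_le0.
Qed.

Let borel_lebesgue_rV_spec n :
  exists m : {sigma_finite_measure set 'rV[R]_n -> \bar R},
    [/\ (m : set _ -> \bar R) = borel_lebesgue_rV n &
      forall a b : 'rV[R]_n, (forall i, a ord0 i <= b ord0 i)%R ->
        m (box a b) = (\prod_(i < n) (b ord0 i - a ord0 i))%:E].
Proof.
elim: n => [|n [m [mE mbox]]].
  exists \d_(0%R : 'rV[R]_0); split => // a b _.
  by rewrite big_ord0 /= diracE mem_set// => -[].
have mc : measurable_fun setT (@cons_rV n) by exact: measurable_cons_rV.
pose m'' : {measure set 'rV[R]_n.+1 -> \bar R} :=
  measure_function_pushforward__canonical__measure_function_Measure
    (@lebesgue_measure R \x m) mc.
have m'box (a b : 'rV[R]_n.+1) : (forall i, a ord0 i <= b ord0 i)%R ->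
    m'' (box a b) = (\prod_(i < n.+1) (b ord0 i - a ord0 i))%:E.
  move=> ab; have -> : m'' (box a b) = (@lebesgue_measure R \x m)
      ([set` `[a ord0 ord0, b ord0 ord0]%R] `*`
       box (\row_i a ord0 (lift ord0 i)) (\row_i b ord0 (lift ord0 i))).
    rewrite /m''/= /pushforward; congr (_ _); apply/seteqP.
    split => -[x y]/=.
      move=> xyab; split => [|i].
        by have := xyab ord0; rewrite cons_rV0.
      by have := xyab (lift ord0 i); rewrite cons_rVS !mxE.
    move=> [xab yab] i; case: (unliftP ord0 i) => [j ->|->].
      by have := yab j; rewrite cons_rVS !mxE.
    by rewrite cons_rV0.
  rewrite product_measure1E//; last exact: measurable_box.
  rewrite mbox; last by move=> i; rewrite !mxE.
  rewrite big_ord_recl EFinM; congr (_ * _); last first.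
    by congr _%:E; apply: eq_bigr => i _; rewrite !mxE.
  apply: (etrans (lebesgue_measure_itv _)); rewrite /= lte_fin EFinB; case: ifPn => //; rewrite -leNgt => ba.
  by rewrite (@le_anti _ _ (a ord0 ord0) (b ord0 ord0)) ?ab// subee.
have sf := sigma_finite_box m'box.
pose sfm := Measure_isSigmaFinite.Build _ _ _ m'' sf.
pose M : {sigma_finite_measure set _ -> \bar R} :=
  HB.pack (m'' : set _ -> \bar R) (Measure.class m'') sfm.
exists M; split => //=.
by rewrite -mE.
Qed.

Let borel_lebesgue_rV0 n : borel_lebesgue_rV n set0 = 0.
Proof. by have [m [<- _]] := borel_lebesgue_rV_spec n; exact: measure0. Qed.

Let borel_lebesgue_rV_ge0 n A : 0 <= borel_lebesgue_rV n A.
Proof. by have [m [<- _]] := borel_lebesgue_rV_spec n; exact: measure_ge0. Qed.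

Let borel_lebesgue_rV_sigma_additive n :
  semi_sigma_additive (borel_lebesgue_rV n).
Proof.
have [m [<- _]] := borel_lebesgue_rV_spec n.
exact: measure_semi_sigma_additive.
Qed.

HB.instance Definition _ n := isMeasure.Build _ _ _ (borel_lebesgue_rV n)
  (borel_lebesgue_rV0 n) (@borel_lebesgue_rV_ge0 n)
  (@borel_lebesgue_rV_sigma_additive n).

Let borel_lebesgue_rV_sigma_finite n : sigma_finite setT (borel_lebesgue_rV n).
Proof.
by have [m [<- _]] := borel_lebesgue_rV_spec n; exact: sigma_finiteT.
Qed.

HB.instance Definition _ n := Measure_isSigmaFinite.Build _ _ _
  (borel_lebesgue_rV n) (@borel_lebesgue_rV_sigma_finite n).

Lemma borel_lebesgue_rV_box n (a b : 'rV[R]_n) :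
  (forall i, a ord0 i <= b ord0 i)%R ->
  borel_lebesgue_rV n (box a b) = (\prod_(i < n) (b ord0 i - a ord0 i))%:E.
Proof. by have [m [<- mbox]] := borel_lebesgue_rV_spec n; exact: mbox. Qed.

(* Lebesgue measure on R^n, on the Lebesgue-measurable sets: the completion of
   the n-fold product of the Lebesgue measure on the Borel sets of R. Its
   underlying measurable type is R^n with the Lebesgue sigma-algebra. *)
Definition lebesgue_rV n :=
  @completed_measure_extension _ _ _ (borel_lebesgue_rV n).
Arguments lebesgue_rV n A : clear implicits.

HB.instance Definition _ n := Measure.on (lebesgue_rV n).

Lemma lebesgue_rV_complete n : measure_is_complete (lebesgue_rV n).
Proof. exact: measure_is_complete_caratheodory. Qed.

Lemma lebesgue_rVE n (A : set 'rV[R]_n) :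
  measurable A -> lebesgue_rV n A = borel_lebesgue_rV n A.
Proof. exact: measurable_mu_extE. Qed.

End lebesgue_measure_rV.
Arguments borel_lebesgue_rV {R} n A.
Arguments lebesgue_rV {R} n A.

(* R^n equipped with the Lebesgue sigma-algebra. *)
Notation lebesgue_type R n :=
  (caratheodory_type (mu_ext (@borel_lebesgue_rV R n))) (only parsing).

Section heat_flow.
Context {R : realType} (n : nat).
Implicit Types (phi : 'rV[R]_n -> R) (x y : 'rV[R]_n) (d t : R).

Definition sqnorm x : R := \sum_(i < n) x ord0 i ^+ 2.

Definition initial_datum phi :=
  [/\ ~ {ae lebesgue_rV n, forall x, phi x = 0},
      forall x, 0 <= phi x,
      bounded_fun phi,
      measurable_fun [set: lebesgue_type R n] phi &
      compact (closure [set x | phi x != 0])].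

Definition heat t phi x : R :=
  (4 * pi * t) `^ (- (n%:R / 2)) *
  (\int[lebesgue_rV n]_y (expR (- (sqnorm (x - y) / (4 * t))) * phi y)).

Definition U d phi x t : R := (4 * pi * t) `^ d * heat t phi x.

End heat_flow.

Section F_concavity.
Context {R : realType}.
Implicit Types (a d r : R) (F : R -> \bar R).

(* A function F : [0, a) -> [-oo, +oo) is represented by a function on R of
   which only the values on [0, a) matter. *)
Definition admissible a F :=
  [/\ forall r, r \in `[0, a[%R -> F r != +oo%E,
      {in `]0, a[%R, continuous F},
      {in `[0, a[%R &, forall r s, r < s -> (F r < F s)%E} &
      F 0 = -oo%E].

(* Below, [fine \o F] is used on (0, a) only, where an admissible F is
   real-valued. *)
Definition C2 a F :=
  forall r, r \in `]0, a[%R ->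
    [/\ derivable (fine \o F) r 1,
        derivable (fine \o F)^`() r 1 &
        {for r, continuous (fine \o F)^`(2)}].

(* The values of F occurring here are < +oo, so that the extended-real sum is
   unambiguous: it is -oo as soon as one of the two terms is. *)
Definition F_concave n a F (f : 'rV[R]_n -> R) :=
  (forall x, f x \in `[0, a[%R) /\
  forall (x y : 'rV[R]_n) (mu : R), 0 < mu < 1 ->
    ((1 - mu)%:E * F (f x) + mu%:E * F (f y)
       <= F (f ((1 - mu) *: x + mu *: y)%R))%E.

Definition eventually_F_concave n a F (u : 'rV[R]_n -> R -> R) :=
  exists2 T : R, 0 < T & forall t, T <= t -> F_concave a F (u ^~ t).

Definition profile a F r : R := fine (F (a * expR (- r))).

Definition kappa a F r : R :=
  - r * (profile a F)^`(2)%classic r / (profile a F)^`()%classic r.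

Definition kappa_limsup a F : \bar R :=
  limf_esup (fun r => (kappa a F r)%:E) (pinfty_nbhs R).

End F_concavity.

(* Main.v *)
Require Import Defs.
From HB Require Import structures.
From mathcomp Require Import all_boot all_order all_algebra.
From mathcomp Require Import all_classical all_reals all_analysis.
From mathcomp Require Import measurable_realfun.
From mathcomp Require Import ring lra.

(** Write [U = a exp(- r)]. Then [r(x, t)] is a constant [c(t)] minus the
    logarithm of [I(x) = int exp(- |x - y|^2 / 4t) phi(y) dy], and [U(., t)] is
    [F]-concave iff [profile a F \o r] is concave, where [profile] is decreasing.
    Let [m] be the mean of the probability measure proportional to
    [exp(- |x0 - y|^2 / 4t) phi(y) dy]. As [phi] has compact support, the
    inequalities [1 + z <= e^z <= z + e^(2 z^2)] give, with [h = x - x0] and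
    [v = (x0 - m) / 2t],
      [r(x0) + v.h + (1 - O(1/t)) |h|^2 / 4t <= r(x) <= r(x0) + v.h + |h|^2 / 4t],
    while [r(x0)] is [t |v|^2] up to a factor [1 +- e] and an additive constant
    which tends to [+oo] with [t] because [d < n / 2].
    (1) If [kappa <= k < 1/2] near [+oo], then [profile] is a concave function of
    [r^(1 - k)], and the lower bound on [r] provides a supporting hyperplane of
    [profile \o r] at every [x0], so that no derivative of [r] is needed.
    (2) If [kappa > k > 1/2] at arbitrarily large arguments, these are values of
    [r(., t)] on a coordinate axis. Concavity of [profile \o r] and the upper
    bound on [r] yield [2 k t |v|^2 <= r(x0)] there, which bounds [r(x0)]. *)

Set Implicit Arguments.
Unset Strict Implicit.
Unset Printing Implicit Defensive.
Import Order.TTheory GRing.Theory Num.Theory.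
Import numFieldNormedType.Exports.

Local Open Scope ring_scope.
Local Open Scope classical_set_scope.

(** * Exponential moments of a weighted measure *)

Lemma expR_le_addr_expR_sqr (R : realType) (z : R) :
  expR z <= z + expR (2 * z ^+ 2).
Proof.
have [z2|z2] := leP z 2^-1; last first.
  have : expR z <= expR (2 * z ^+ 2) by rewrite ler_expR; nra.
  by move=> /le_trans; apply; rewrite lerDr; lra.
(* Here [z <= 2^-1], so [expR z <= (1 - z)^-1], and [(1 - z) * (1 + z + 2 * z ^+ 2) = 1 + z ^+ 2 *
   (1 - 2 * z) >= 1]. *)
apply: (@le_trans _ _ (1 + z + 2 * z ^+ 2)); last first.
  by rewrite (addrC 1) -addrA lerD2l expR_ge1Dx.
have z1 : 0 < 1 - z by lra.
have e1 : expR z <= (1 - z)^-1.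
  rewrite -[z in expR z]opprK expRN lef_pV2 ?posrE ?expR_gt0//.
  exact: expR_ge1Dx.
apply: (le_trans e1); rewrite -div1r ler_pdivrMr//.
have : 0 <= z ^+ 2 * (1 - 2 * z) by rewrite mulr_ge0 ?sqr_ge0//; lra.
lra.
Qed.

Lemma Rintegral_sum d (T : measurableType d) (R : realType)
    (mu : {measure set T -> \bar R}) (I : Type) (s : seq I) (f : I -> T -> R) :
  (forall i, mu.-integrable setT (EFin \o f i)) ->
  mu.-integrable setT (EFin \o (fun y => \sum_(i <- s) f i y)) /\
  \int[mu]_y (\sum_(i <- s) f i y) = \sum_(i <- s) \int[mu]_y f i y.
Proof.
move=> fi; elim: s => [|i s [iS ES]].
  rewrite (_ : (fun y => _) = cst 0); last first.
    by apply/funext => y; rewrite big_nil.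
  by rewrite big_nil Rintegral_cst// mul0r; split => //; exact: integrable0.
rewrite (_ : (fun y => _) = fun y => f i y + \sum_(j <- s) f j y); last first.
  by apply/funext => y; rewrite big_cons.
rewrite big_cons.
split; last by rewrite RintegralD// ES.
rewrite (_ : _ \o _ = (EFin \o f i) \+ (EFin \o (fun y => (\sum_(j <- s) f j y)%R)))%E//.
exact: integrableD.
Qed.

Section weighted_integral.
Context d (T : measurableType d) (R : realType).
Variables (mu : {measure set T -> \bar R}) (w : T -> R).
Hypothesis w0 : forall y, 0 <= w y.
Hypothesis intw : mu.-integrable setT (EFin \o w).
Implicit Types (g l : T -> R) (C : R).

Let measurable_w : measurable_fun setT w.
Proof. by move/integrableP : intw => [/measurable_EFinP]. Qed.

(** Bounds are asked only where [w] does not vanish: for a weight built from the datum, the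
    coordinates of [y] are bounded there but not on the whole space. *)
Lemma integrable_bounded_weight g C : measurable_fun setT g ->
  (forall y, w y != 0 -> `|g y| <= C) ->
  mu.-integrable setT (EFin \o (fun y => g y * w y)).
Proof.
move=> mg gC.
apply: (@le_integrable _ _ _ mu _ measurableT _ (EFin \o (fun y => C * w y))).
- by apply/measurable_EFinP; exact: measurable_funM.
- move=> y _; rewrite /= lee_fin !normrM.
  have [->|/gC gyC] := eqVneq (w y) 0; first by rewrite normr0 !mulr0.
  by rewrite ler_wpM2r// (le_trans gyC)// ler_norm.
- rewrite (_ : _ \o _ = fun y => (C%:E * (EFin \o w) y)%E)//.
  exact: integrableZl.
Qed.

Lemma le_weighted_integral g l C : measurable_fun setT g -> measurable_fun setT l ->
  (forall y, w y != 0 -> `|g y| <= C) -> (forall y, w y != 0 -> `|l y| <= C) ->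
  (forall y, w y != 0 -> g y <= l y) ->
  \int[mu]_y (g y * w y) <= \int[mu]_y (l y * w y).
Proof.
move=> mg ml gC lC gl; apply: le_Rintegral => //.
- exact: integrable_bounded_weight gC.
- exact: integrable_bounded_weight lC.
- move=> y _; have [->|wy] := eqVneq (w y) 0; first by rewrite !mulr0.
  by rewrite ler_wpM2r// gl.
Qed.

Lemma weighted_integral_le g C B : measurable_fun setT g ->
  (forall y, w y != 0 -> `|g y| <= C) -> (forall y, w y != 0 -> g y <= B) ->
  \int[mu]_y (g y * w y) <= B * \int[mu]_y w y.
Proof.
move=> mg gC gB; rewrite -RintegralZl//.
apply: (@le_weighted_integral g (cst B) (Num.max C `|B|)) => //.
- by move=> y /gC gyC; rewrite le_max gyC.
- by move=> y _; rewrite le_max lexx orbT.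
Qed.

Lemma weighted_integral_ge g C B : measurable_fun setT g ->
  (forall y, w y != 0 -> `|g y| <= C) -> (forall y, w y != 0 -> B <= g y) ->
  B * \int[mu]_y w y <= \int[mu]_y (g y * w y).
Proof.
move=> mg gC gB; rewrite -RintegralZl//.
apply: (@le_weighted_integral (cst B) g (Num.max C `|B|)) => //.
- by move=> y _; rewrite le_max lexx orbT.
- by move=> y /gC gyC; rewrite le_max gyC.
Qed.

(** Integrate [1 + l <= expR l <= l + expR (2 * C)] against [w]: the linear terms vanish because [l]
    has mean zero, which leaves an error of second order in [l]. *)
Lemma exp_moment_centered l C : measurable_fun setT l ->
  (forall y, w y != 0 -> l y ^+ 2 <= C) -> \int[mu]_y (l y * w y) = 0 ->
  \int[mu]_y w y <= \int[mu]_y (expR (l y) * w y) <=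
    expR (2 * C) * \int[mu]_y w y.
Proof.
move=> ml lC l0.
have lB y : w y != 0 -> `|l y| <= 1 + C.
  move=> /lC lyC; have := sqr_ge0 (`|l y| - 1); have := normr_ge0 (l y).
  have := real_normK (num_real (l y)); rewrite !expr2; nra.
have il := integrable_bounded_weight ml lB.
have mel : measurable_fun setT (fun y => expR (l y)) by exact: measurableT_comp.
have eB y : w y != 0 -> `|expR (l y)| <= expR (1 + C).
  by move=> /lB lyB; rewrite ger0_norm ?expR_ge0// ler_expR (le_trans _ lyB)// ler_norm.
have iel := integrable_bounded_weight mel eB.
have splitE c : \int[mu]_y (l y * w y + c * w y) = c * \int[mu]_y w y.
  rewrite RintegralD//; first by rewrite l0 add0r RintegralZl.
  apply: (@integrable_bounded_weight (cst c) `|c|) => //.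
have icl c : mu.-integrable setT (EFin \o (fun y => l y * w y + c * w y)).
  rewrite (_ : _ \o _ = EFin \o (fun y => (l y + c) * w y)); last first.
    by apply/funext => y /=; rewrite mulrDl.
  apply: (@integrable_bounded_weight (fun y => l y + c) (1 + C + `|c|)).
    exact: measurable_funD.
  by move=> y /lB lyB; rewrite (le_trans (ler_normD _ _))// lerD2r.
apply/andP; split.
  rewrite -[leLHS]mul1r -splitE; apply: le_Rintegral => // y _.
  by rewrite -mulrDl ler_wpM2r// addrC expR_ge1Dx.
rewrite -splitE; apply: le_Rintegral => // y _.
have [->|wy] := eqVneq (w y) 0; first by rewrite !mulr0 addr0.
rewrite -mulrDl ler_wpM2r// (le_trans (expR_le_addr_expR_sqr _))//.
by rewrite lerD2l ler_expR ler_wpM2l// lC.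
Qed.

End weighted_integral.

(** * Gaussian integrals of the datum *)

Section heat_estimates.
Context (R : realType) (n : nat).
Local Notation mu := (@lebesgue_rV R n).
Local Notation rV := 'rV[R]_n.
Implicit Types (x y m : rV).

Lemma measurable_lebesgue_coord (i : 'I_n) :
  measurable_fun [set: lebesgue_type R n] (fun y : lebesgue_type R n => (y : rV) ord0 i).
Proof.
move=> _ B mB; rewrite setTI.
apply: caratheodory_measurable_mu_ext.
by have := measurable_coord i measurableT mB; rewrite setTI.
Qed.

Lemma measurable_lebesgue_sum (g : 'I_n -> R -> R) :
  (forall i, measurable_fun setT (g i)) ->
  measurable_fun [set: lebesgue_type R n]
    (fun y : lebesgue_type R n => \sum_(i < n) g i ((y : rV) ord0 i)).
Proof.
move=> mg; apply: measurable_sum => i.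
exact: (measurableT_comp (mg i) (measurable_lebesgue_coord i)).
Qed.

Section datum.
Variable phi : rV -> R.
Hypothesis hphi : initial_datum phi.

Lemma initial_datum_ge0 y : 0 <= phi y.
Proof. by case: hphi. Qed.

Lemma initial_datum_support :
  exists2 rho : R, 0 <= rho & forall y, phi y != 0 -> forall i, `|y ord0 i| <= rho.
Proof.
case: hphi => _ _ _ _ /compact_bounded[N [Nr bN]].
have N0 : N < `|N| + 1 by rewrite (le_lt_trans (ler_norm N))// ltrDl.
exists (`|N| + 1); first by rewrite addr_ge0.
move=> y y0 i; apply: le_trans (bN _ N0 y _); last exact: subset_closure.
rewrite [leRHS]mx_normrE.
exact: (le_bigmax _ (fun ij : 'I_1 * 'I_n => `|y ij.1 ij.2|) (ord0, i)).
Qed.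

(** The datum is bounded and vanishes outside a cube of finite measure. *)
Lemma initial_datum_integrable : mu.-integrable setT (EFin \o phi).
Proof.
have [rho rho0 Hrho] := initial_datum_support.
case: hphi => _ phi0 bphi mphi _.
pose B : set rV := box (const_mx (- rho)) (const_mx rho).
have mB : measurable (B : set (lebesgue_type R n)).
  exact: caratheodory_measurable_mu_ext (measurable_box _ _).
have muB : (mu B < +oo)%E.
  rewrite lebesgue_rVE; last exact: measurable_box.
  rewrite borel_lebesgue_rV_box ?ltry// => i; rewrite !mxE.
  by rewrite (le_trans _ rho0)// oppr_le0.
have := @measurable_bounded_integrable _ _ _ mu phi B mB muB.
move=> /(_ (measurable_funTS mphi)) H.
have {}H : mu.-integrable B (EFin \o phi).
  apply: H; case: bphi => N [Nr bN]; exists N; split => // z Nz y _.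
  exact: bN.
move/(integrable_mkcond _ mB): H; congr (_.-integrable _ _).
apply/funext => y; rewrite patchE; case: ifPn => // /negP yB /=.
have [->//|/Hrho yrho] := eqVneq (phi y) 0; exfalso; apply: yB.
by rewrite inE => i; rewrite !mxE in_itv /= -ler_norml yrho.
Qed.

(** A nonnegative function with zero integral vanishes almost everywhere, which [initial_datum]
    excludes. *)
Lemma initial_datum_mass_gt0 : 0 < \int[mu]_y phi y.
Proof.
case: hphi => nae phi0 _ mphi _.
have : 0 <= \int[mu]_y phi y by apply: Rintegral_ge0 => y _; exact: phi0.
rewrite le_eqVlt => /predU1P[E|//]; exfalso; apply: nae.
have mEphi : measurable_fun [set: lebesgue_type R n] (EFin \o phi).
  exact/measurable_EFinP.
have /(ae_eq_integral_abs mu measurableT mEphi) [N [mN muN HN]] :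
    (\int[mu]_y `|(EFin \o phi) y| = 0)%E.
  under eq_integral do rewrite /= ger0_norm ?phi0//.
  have := integrable_fin_num measurableT initial_datum_integrable.
  by move=> /fineK <-; rewrite [fine _](esym E).
exists N; split => // y /= phiy; apply: HN => /= /(_ I) [].
by move: phiy => /[swap] -> .
Qed.

End datum.

Definition dotprod x y : R := \sum_(i < n) x ord0 i * y ord0 i.

Lemma sqnorm_ge0 x : 0 <= sqnorm x.
Proof. by apply: sumr_ge0 => i _; exact: sqr_ge0. Qed.

Lemma sqnormD x y : sqnorm (x + y) = sqnorm x + 2 * dotprod x y + sqnorm y.
Proof.
rewrite /sqnorm /dotprod mulr_sumr -!big_split /=; apply: eq_bigr => i _.
by rewrite mxE; ring.
Qed.

Lemma dotprodDr x y z : dotprod x (y + z) = dotprod x y + dotprod x z.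
Proof.
by rewrite /dotprod -big_split /=; apply: eq_bigr => i _; rewrite mxE mulrDr.
Qed.

Lemma dotprodZr (c : R) x y : dotprod x (c *: y) = c * dotprod x y.
Proof.
by rewrite /dotprod mulr_sumr; apply: eq_bigr => i _; rewrite mxE mulrCA.
Qed.

Lemma dotprodBl x y z : dotprod (x - y) z = dotprod x z - dotprod y z.
Proof.
by rewrite /dotprod -sumrB; apply: eq_bigr => i _; rewrite !mxE mulrBl.
Qed.

Lemma sqnormN x : sqnorm (- x) = sqnorm x.
Proof. by apply: eq_bigr => i _; rewrite mxE sqrrN. Qed.

(** Cauchy-Schwarz: [y] minus its projection on [x] has nonnegative squared norm. *)
Lemma dotprod_sqr_le x y : dotprod x y ^+ 2 <= sqnorm x * sqnorm y.
Proof.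
have [x0|xn0] := eqVneq (sqnorm x) 0.
  suff -> : dotprod x y = 0 by rewrite x0 mul0r expr0n.
  apply: big1 => i _; have := @psumr_eq0P R _ xpredT (fun i => x ord0 i ^+ 2)
    (fun i _ => sqr_ge0 _) x0 i isT => /eqP.
  by rewrite sqrf_eq0 => /eqP ->; rewrite mul0r.
have xp : 0 < sqnorm x by rewrite lt0r xn0 sqnorm_ge0.
have := sqnorm_ge0 (y + (- (dotprod x y / sqnorm x)) *: x).
rewrite sqnormD dotprodZr.
have -> : dotprod y x = dotprod x y by apply: eq_bigr => i _; rewrite mulrC.
have -> c : sqnorm (c *: x) = c ^+ 2 * sqnorm x.
  by rewrite /sqnorm mulr_sumr; apply: eq_bigr => i _; rewrite mxE exprMn.
set p := dotprod x y.
have -> : sqnorm y + 2 * (- (p / sqnorm x) * p) + (- (p / sqnorm x)) ^+ 2 * sqnorm x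
  = (sqnorm x * sqnorm y - p ^+ 2) / sqnorm x by field.
by rewrite pmulr_lge0 ?invr_gt0// subr_ge0.
Qed.

(** Young's inequality with weight [e]. Together with [sqnorm_lb], it makes a bounded shift cost a
    factor close to 1 and an additive constant. *)
Lemma sqnorm_ub x y (e : R) : 0 < e ->
  sqnorm (x + y) <= (1 + e) * sqnorm x + (1 + e^-1) * sqnorm y.
Proof.
move=> e0; rewrite /sqnorm !mulr_sumr -big_split /=; apply: ler_sum => i _.
rewrite mxE -subr_ge0; set p := x _ _; set q := y _ _.
have -> : (1 + e) * p ^+ 2 + (1 + e^-1) * q ^+ 2 - (p + q) ^+ 2
    = (e * p - q) ^+ 2 / e by field; rewrite gt_eqF.
by rewrite divr_ge0 ?sqr_ge0// ltW.
Qed.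

Lemma sqnorm_lb x y (e : R) : 0 < e ->
  (1 - e) * sqnorm x - (1 + e^-1) * sqnorm y <= sqnorm (x + y).
Proof.
move=> e0; rewrite /sqnorm !mulr_sumr -sumrB /=; apply: ler_sum => i _.
rewrite mxE -subr_ge0; set p := x _ _; set q := y _ _.
have -> : (p + q) ^+ 2 - ((1 - e) * p ^+ 2 - (1 + e^-1) * q ^+ 2)
    = (e * p + q) ^+ 2 / e + 2 * q ^+ 2 by field; rewrite gt_eqF.
by apply: addr_ge0; [apply: divr_ge0; [exact: sqr_ge0|exact: ltW]|
  rewrite mulr_ge0 ?sqr_ge0].
Qed.

Lemma measurable_sqnormB x : measurable_fun [set: lebesgue_type R n]
  (fun y : lebesgue_type R n => sqnorm (x - (y : rV))).
Proof.
rewrite (_ : (fun _ => _) = fun y => \sum_(i < n) (fun r : R => (x ord0 i - r) ^+ 2) ((y : rV) ord0 i)).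
  apply: (@measurable_lebesgue_sum (fun i r => (x ord0 i - r) ^+ 2)) => i.
  apply: measurable_funX.
  exact: measurable_funB.
by apply/funext => y; apply: eq_bigr => i _; rewrite !mxE.
Qed.

(** The heat flow without its normalising power of [4 * pi * t]. *)
Definition gauss (t : R) (phi : rV -> R) x : R :=
  \int[mu]_y (expR (- (sqnorm (x - y) / (4 * t))) * phi y).

Section gauss_estimates.
Variables (phi : rV -> R) (rho t : R).
Hypothesis hphi : initial_datum phi.
Hypothesis rho0 : 0 <= rho.
Hypothesis hrho : forall y, phi y != 0 -> forall i, `|y ord0 i| <= rho.
Hypothesis t0 : 0 < t.

(** The squared diagonal [n (2 rho)^2] of the cube of half-side [rho], which contains the support of
    the datum and the means [m] below. *)
Definition support_cst : R := 4 * n%:R * rho ^+ 2.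

Lemma sqnormB_support x y : (forall i, `|x ord0 i| <= rho) ->
  (forall i, `|y ord0 i| <= rho) -> sqnorm (x - y) <= support_cst.
Proof.
move=> xr yr; apply: (@le_trans _ _ (\sum_(i < n) 4 * rho ^+ 2)).
  apply: ler_sum => i _; rewrite !mxE; have := xr i; have := yr i.
  rewrite !ler_norml; nra.
by rewrite sumr_const cardT size_enum_ord /support_cst -mulr_natl; lra.
Qed.

Lemma measurable_gauss_kernel x : measurable_fun [set: lebesgue_type R n]
  (fun y : lebesgue_type R n => expR (- (sqnorm (x - (y : rV)) / (4 * t)))).
Proof.
apply: (measurableT_comp (@measurable_expR R)).
apply: (measurableT_comp (@oppr_measurable R _)).
apply: measurable_funM; first exact: measurable_sqnormB.
exact: measurable_cst.
Qed.

Lemma gauss_kernel_le1 x y : `|expR (- (sqnorm (x - y) / (4 * t)))| <= 1.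
Proof.
rewrite ger0_norm ?expR_ge0// expR_le1 oppr_le0 divr_ge0 ?sqnorm_ge0//.
by rewrite mulr_ge0// ltW.
Qed.

(** Split [x - y] as [(x - m) + (m - y)]; on the support of [phi] the second term has squared norm
    at most [support_cst], so the kernel is bounded pointwise. *)
Lemma gauss_bounds x m (e : R) : 0 < e -> (forall i, `|m ord0 i| <= rho) ->
  expR (- (((1 + e) * sqnorm (x - m) + (1 + e^-1) * support_cst) / (4 * t))) *
    \int[mu]_y phi y <= gauss t phi x <=
  expR (- (((1 - e) * sqnorm (x - m) - (1 + e^-1) * support_cst) / (4 * t))) *
    \int[mu]_y phi y.
Proof.
move=> e0 mr.
have t4 : 0 < (4 * t)^-1 by rewrite invr_gt0 mulr_gt0.
have e1 : 0 <= 1 + e^-1 by rewrite addr_ge0// invr_ge0 ltW.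
have K y : phi y != 0 -> (1 + e^-1) * sqnorm (m - y) <= (1 + e^-1) * support_cst.
  by move=> /hrho yr; rewrite ler_wpM2l// sqnormB_support.
apply/andP; split.
  apply: (@weighted_integral_ge _ _ _ mu phi _ _ _ 1).
  - exact: initial_datum_ge0.
  - exact: initial_datum_integrable.
  - exact: measurable_gauss_kernel.
  - by move=> y _; exact: gauss_kernel_le1.
  - move=> y /K {}K; rewrite ler_expR lerN2 ler_pM2r//.
    rewrite -(subrKA m) (le_trans (sqnorm_ub _ _ e0))//.
    by rewrite lerD2l.
apply: (@weighted_integral_le _ _ _ mu phi _ _ _ 1).
- exact: initial_datum_ge0.
- exact: initial_datum_integrable.
- exact: measurable_gauss_kernel.
- by move=> y _; exact: gauss_kernel_le1.
- move=> y /K {}K; rewrite ler_expR lerN2 ler_pM2r//.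
  rewrite -[in leRHS](subrKA m) (le_trans _ (sqnorm_lb _ _ e0))//.
  by rewrite lerD2l lerN2.
Qed.

Lemma gauss_gt0 x : 0 < gauss t phi x.
Proof.
have [|/lt_le_trans + _] := andP (@gauss_bounds x 0 1 ltr01 _).
  by move=> i; rewrite mxE normr0.
apply; rewrite mulr_gt0 ?expR_gt0//; exact: initial_datum_mass_gt0.
Qed.

(* [m] is the mean of the measure [exp(-|x0 - y|^2 / 4t) phi(y) dy]; recentring
   at [x] multiplies its density by the exponential of an affine function. *)
Lemma gauss_tilt x0 : exists m, (forall i, `|m ord0 i| <= rho) /\
  forall x, gauss t phi x0 *
      expR (- ((sqnorm (x - x0) + 2 * dotprod (x0 - m) (x - x0)) / (4 * t)))
    <= gauss t phi x <=
    gauss t phi x0 *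
      expR (- ((sqnorm (x - x0) + 2 * dotprod (x0 - m) (x - x0)) / (4 * t))
            + support_cst * sqnorm (x - x0) / (2 * t ^+ 2)).
Proof.
pose w y : R := expR (- (sqnorm (x0 - y) / (4 * t))) * phi y.
have w0 y : 0 <= w y by rewrite mulr_ge0 ?expR_ge0 ?initial_datum_ge0.
have iw : mu.-integrable setT (EFin \o w).
  exact: (integrable_bounded_weight
    (initial_datum_integrable hphi) (measurable_gauss_kernel x0)
    (fun y _ => gauss_kernel_le1 x0 y)).
have wphi y : w y != 0 -> phi y != 0 by rewrite mulf_eq0 negb_or => /andP[].
pose W := \int[mu]_y w y.
have WE : W = gauss t phi x0 by [].
have Wgt0 : 0 < W by exact: gauss_gt0.
have mcoord (i : 'I_n) := measurable_lebesgue_coord i.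
pose m : rV := \row_i (W^-1 * \int[mu]_y (y ord0 i * w y)).
(* A weighted average of points of the cube stays in the cube. *)
have mr i : `|m ord0 i| <= rho.
  rewrite mxE ler_norml ler_pdivrMl// ler_pdivlMl// !(mulrC W).
  apply/andP; split.
    apply: (@weighted_integral_ge _ _ _ mu w w0 iw _ rho _ (mcoord i)) => y /wphi/hrho //.
    by move=> /(_ i); rewrite ler_norml => /andP[].
  apply: (@weighted_integral_le _ _ _ mu w w0 iw _ rho _ (mcoord i)) => y /wphi/hrho //.
  by move=> /(_ i); rewrite ler_norml => /andP[].
exists m; split => // x.
pose h := x - x0.
(* Expand [sqnorm (x - y)] around [x0 - y = (x0 - m) - (y - m)]: the only part of the new exponent
   that depends on [y] is [l y], and the choice of [m] gives it mean zero. *)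
pose l y : R := dotprod (y - m) h / (2 * t).
have ml : measurable_fun [set: lebesgue_type R n] (l : lebesgue_type R n -> R).
  apply: measurable_funM; last exact: measurable_cst.
  rewrite (_ : (fun _ => _) = fun y => \sum_(i < n) (fun r : R => (r - m ord0 i) * h ord0 i) ((y : rV) ord0 i)).
    apply: (@measurable_lebesgue_sum (fun i r => (r - m ord0 i) * h ord0 i)) => i.
    apply: measurable_funM; last exact: measurable_cst.
    exact: measurable_funB.
  by apply/funext => y; apply: eq_bigr => i _; rewrite !mxE.
have lC y : w y != 0 -> l y ^+ 2 <= support_cst * sqnorm h / (4 * t ^+ 2).
  move=> /wphi/hrho yr.
  rewrite (_ : l y ^+ 2 = dotprod (y - m) h ^+ 2 / (4 * t ^+ 2)); last first.
    by rewrite /l; field; rewrite gt_eqF.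
  rewrite ler_pM2r ?invr_gt0 ?mulr_gt0 ?exprn_gt0//.
  rewrite (le_trans (dotprod_sqr_le _ _))// ler_wpM2r ?sqnorm_ge0//.
  exact: sqnormB_support.
have l0 : \int[mu]_y (l y * w y) = 0.
  have il i : mu.-integrable setT (EFin \o (fun y : rV => (y ord0 i - m ord0 i) * w y)).
    apply: (@integrable_bounded_weight _ _ _ mu w iw _ (2 * rho)).
      exact: measurable_funB.
    move=> y /wphi/hrho yr; rewrite (le_trans (ler_normB _ _))//.
    by have := yr i; have := mr i; lra.
  have il1 i : mu.-integrable setT (EFin \o (fun y : rV => y ord0 i * w y)).
    apply: (@integrable_bounded_weight _ _ _ mu w iw _ rho) => //.
    by move=> y /wphi/hrho.
  have iil i : \int[mu]_y ((y ord0 i - m ord0 i) * w y) = 0.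
    under eq_Rintegral do rewrite mulrBl.
    rewrite RintegralB//; last first.
      exact: (@integrable_bounded_weight _ _ _ mu w iw (cst (m ord0 i)) `|m ord0 i|).
    rewrite RintegralZl// -/W mxE mulrAC mulVf ?mul1r ?subrr//.
    by rewrite gt_eqF.
  have -> : (fun y : rV => l y * w y) = (fun y : rV => \sum_(i < n)
      (h ord0 i / (2 * t)) * ((y ord0 i - m ord0 i) * w y)).
    apply/funext => y; rewrite /l /dotprod mulr_suml mulr_suml.
    by apply: eq_bigr => i _; rewrite !mxE; ring.
  rewrite (Rintegral_sum _ _).2; last first.
    by move=> i; exact: (@integrableZl _ _ _ mu _ measurableT _ _ (il i)).
  by apply: big1 => i _; rewrite RintegralZl// iil mulr0.
have /andP[lo up] := @exp_moment_centered _ _ _ mu w w0 iw l _ ml lC l0.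
have -> : gauss t phi x =
    expR (- ((sqnorm h + 2 * dotprod (x0 - m) h) / (4 * t))) *
    \int[mu]_y (expR (l y) * w y).
  have iel : mu.-integrable setT (EFin \o (fun y : rV => expR (l y) * w y)).
    have lB y : w y != 0 -> `|expR (l y)| <= expR (1 + support_cst * sqnorm h / (4 * t ^+ 2)).
      move=> wy; rewrite ger0_norm ?expR_ge0// ler_expR.
      by have := lC _ wy; have := sqr_ge0 (l y - 2^-1); lra.
    by apply: (@integrable_bounded_weight _ _ _ mu w iw _ _ _ lB); exact: (measurableT_comp (@measurable_expR R)).
  rewrite -(RintegralZl _ measurableT iel).
  apply: eq_Rintegral => y _; rewrite /w !mulrA -!expRD; congr (expR _ * _).
  have -> : x - y = (x0 - y) + h by rewrite /h [RHS]addrC addrA subrK.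
  rewrite sqnormD /l !dotprodBl; field.
  by rewrite gt_eqF.
rewrite -WE expRD (mulrC W) (mulrCA W) !ler_pM2l ?expR_gt0// (mulrC W).
rewrite lo (le_trans up)// ler_pM2r//.
by rewrite (_ : 2 * _ = support_cst * sqnorm h / (2 * t ^+ 2))//; field; rewrite gt_eqF.
Qed.

End gauss_estimates.
End heat_estimates.

(** * Power functions and the mean value theorem *)

Lemma powR_le_affine (R : realType) (y theta : R) : 0 <= y -> 0 < theta < 1 ->
  y `^ theta <= theta * y + (1 - theta).
Proof.
move=> y0 /andP[t0 t1].
have t1' : 0 < 1 - theta by rewrite subr_gt0.
have := @conjugate_powR R (y `^ theta) 1 theta^-1 (1 - theta)^-1 (powR_ge0 _ _) ler01.
rewrite !invr_gt0 !invrK subrKC => /(_ t0 t1' erefl).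
by rewrite -powRrM divff ?gt_eqF// powRr1// powR1 mulr1 mul1r mulrC.
Qed.

(* [1 + s + p (1 - p) s ^ 2 = (1 + p s) (1 + (1 - p) s)] *)
Lemma powR_ge_affine (R : realType) (p s r0 r : R) : 2^-1 < p < 1 -> 0 < r0 ->
  r0 * (1 + s + p * (1 - p) * s ^+ 2) <= r -> r0 `^ p * (1 + p * s) <= r `^ p.
Proof.
move=> /andP[p2 p1] r00 rr; have p0 : 0 < p by lra.
have [y0|y0] := leP (1 + p * s) 0.
  by rewrite (@le_trans _ _ 0) ?powR_ge0// mulr_ge0_le0// powR_ge0.
set y := 1 + p * s in y0 *.
have ptheta : p * ((1 - p) / p) = 1 - p by rewrite mulrC divfK// gt_eqF.
(* The exponent lies in (0, 1) because [p > 2^-1]. Multiplying by [y] then bounds [y] to the power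
   [1 / p] by the product in the factorisation above. *)
have ytheta : y `^ ((1 - p) / p) <= 1 + (1 - p) * s.
  rewrite (le_trans (powR_le_affine (ltW y0) _))//.
    by rewrite divr_gt0 ?subr_gt0// ltr_pdivrMr// mul1r; lra.
  by rewrite /y le_eqVlt; apply/orP; left; apply/eqP; field; rewrite gt_eqF.
have yy : y <= (y * (1 + (1 - p) * s)) `^ p.
  apply: (@le_trans _ _ ((y * y `^ ((1 - p) / p)) `^ p)).
    rewrite powRM ?powR_ge0 ?(ltW y0)// -powRrM (mulrC _ p) ptheta -powRD; last first.
      by rewrite (gt_eqF y0) implybT.
    by rewrite addrC subrK powRr1 ?(ltW y0).
  rewrite ge0_ler_powR ?nnegrE ?(ltW p0) ?mulr_ge0 ?powR_ge0 ?(ltW y0)//.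
    by rewrite (le_trans _ ytheta)// powR_ge0.
  by rewrite ler_pM2l.
have z0 : 0 <= 1 + (1 - p) * s by rewrite (le_trans _ ytheta)// powR_ge0.
apply: (@le_trans _ _ (r0 `^ p * (y * (1 + (1 - p) * s)) `^ p)).
  by rewrite ler_wpM2l ?powR_ge0.
rewrite -powRM ?(ltW r00) ?mulr_ge0 ?(ltW y0)//.
have E : r0 * (y * (1 + (1 - p) * s)) = r0 * (1 + s + p * (1 - p) * s ^+ 2).
  by rewrite /y; ring.
rewrite ge0_ler_powR ?nnegrE ?E// ?(ltW p0)//.
  by rewrite -E !mulr_ge0 ?(ltW r00) ?(ltW y0).
by rewrite (le_trans _ rr)// -E !mulr_ge0 ?(ltW r00) ?(ltW y0).
Qed.

(** The endpoints may come in either order, since [profile_tangent] compares unordered levels. *)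
Lemma mean_value (R : realType) (f df : R -> R) (x y : R) :
  (forall z, Num.min x y <= z <= Num.max x y -> is_derive z 1 f (df z)) ->
  exists2 z, Num.min x y <= z <= Num.max x y & f y - f x = df z * (y - x).
Proof.
wlog xy : x y / x <= y => [H|].
  have /orP[xy|yx] := le_total x y; first exact: H.
  rewrite minC maxC => /(H _ _ yx)[z zxy E].
  by exists z => //; rewrite -opprB E; ring.
rewrite (min_idPl xy) (max_idPr xy) => fdf.
have [||z zxy E] := @MVT_segment R f df x y xy.
- by move=> z; rewrite in_itv/= => /andP[xz zy]; apply: fdf; rewrite !ltW.
- apply: derivable_within_continuous => z; rewrite in_itv/= => zxy.
  by have [] := fdf z zxy.
by exists z => //; rewrite in_itv in zxy.
Qed.

(** * Curvature of a decreasing function of one variable *)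

Section decreasing_profile.
Context (R : realType).
Variables f df ddf : R -> R.
Hypothesis is_derive_f : forall r : R, 0 < r -> is_derive r 1 f (df r).
Hypothesis is_derive_df : forall r : R, 0 < r -> is_derive r 1 df (ddf r).
Hypothesis df_lt0 : forall r : R, 0 < r -> df r < 0.

Section curvature_upper_bound.
Variables (k r1 : R).
Hypothesis k01 : 0 < k < 2^-1.
Hypothesis r10 : 0 <= r1.
Hypothesis curv : forall r : R, r1 < r -> - r * ddf r / df r <= k.

Let powR_df_nincr (x y : R) : r1 < x -> x <= y -> y `^ k * df y <= x `^ k * df x.
Proof.
move=> rx xy.
pose G := (@powR R ^~ k) * df.
pose dG z := z `^ k * ddf z + df z * (k * z `^ (k - 1)).
have [z|z /andP[xz zy] E] := @mean_value R G dG x y.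
  rewrite (min_idPl xy) => /andP[xz _].
  have z0 : 0 < z := le_lt_trans r10 (lt_le_trans rx xz).
  by apply: is_deriveM => //; [exact: is_derive1_powR|exact: is_derive_df].
rewrite -subr_le0 [leLHS]E mulr_le0_ge0 ?subr_ge0//.
rewrite (min_idPl xy) in xz.
have z0 : 0 < z := le_lt_trans r10 (lt_le_trans rx xz).
have := curv (lt_le_trans rx xz).
rewrite ler_ndivrMr ?df_lt0// => cz.
have -> : dG z = z `^ (k - 1) * (z * ddf z + k * df z).
  rewrite /dG powRB ?(gt_eqF z0) ?implybT// powRr1 ?(ltW z0)//; field.
  by rewrite gt_eqF.
by rewrite mulr_ge0_le0 ?powR_ge0//; lra.
Qed.

(** The tangent of [f] at [r0] in the variable [r]^ (1 - k)[lies above]f[. Its slope is negative, so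
    the lower bound of]powR_ge_affine[on]r [^ (1 - k)], which is affine in [s], can be
    substituted. *)
Lemma profile_tangent (r0 r s : R) : r1 < r0 -> r1 < r ->
  r0 * (1 + s + (1 - k) * k * s ^+ 2) <= r -> f r <= f r0 + df r0 * (r0 * s).
Proof.
move=> rr0 rr le_r; have /andP[k0 k2] := k01.
have r00 : 0 < r0 := le_lt_trans r10 rr0.
have r0' : 0 < r := le_lt_trans r10 rr.
have p0 : 0 < 1 - k by lra.
(* [c] is the derivative of [f] at [r0] with respect to [r]^ (1 - k)[. By monotonicity of]z
   [^ k * df z], the difference [J] increases before [r0] and decreases after it. *)
pose c := df r0 * r0 `^ k / (1 - k).
pose J := f - (c *: (@powR R ^~ (1 - k))).
pose dJ z := df z - c * ((1 - k) * z `^ (1 - k - 1)).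
have JJ : J r <= J r0.
  have [z /andP[z1 z2]|z /andP[z1 z2] E] := @mean_value R J dJ r0 r.
    have z0 : 0 < z by rewrite (lt_le_trans _ z1)// lt_min r00.
    by apply: is_deriveB; [exact: is_derive_f|
      apply: is_deriveZ; exact: is_derive1_powR].
  have z0 : 0 < z by rewrite (lt_le_trans _ z1)// lt_min r00.
  have rz : r1 < z by rewrite (lt_le_trans _ z1)// lt_min rr0.
  rewrite -subr_le0 E.
  have -> : dJ z = z `^ (- k) * (z `^ k * df z - r0 `^ k * df r0).
    rewrite /dJ /c (_ : 1 - k - 1 = - k); last ring.
    rewrite mulrBr [z `^ (- k) * (z `^ k * _)]mulrA -powRD ?(gt_eqF z0) ?implybT// addNr powRr0 mul1r.
    by field; rewrite gt_eqF.
  rewrite -mulrA mulr_ge0_le0 ?powR_ge0//.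
  have [r0r|/ltW rr0'] := leP r0 r.
    rewrite (min_idPl r0r) in z1.
    by rewrite mulr_le0_ge0 ?subr_ge0// subr_le0 powR_df_nincr.
  rewrite (max_idPl rr0') in z2.
  by rewrite mulr_ge0_le0 ?subr_le0// subr_ge0 powR_df_nincr.
have hp : r0 `^ (1 - k) * (1 + (1 - k) * s) <= r `^ (1 - k).
  apply: powR_ge_affine => //; first by apply/andP; lra.
  by rewrite subKr.
have c0 : c <= 0.
  by rewrite /c -mulrA mulr_le0_ge0 ?(ltW (df_lt0 _))// divr_ge0 ?powR_ge0 ?ltW.
have {}JJ : f r - c * r `^ (1 - k) <= f r0 - c * r0 `^ (1 - k) by [].
have : c * (r `^ (1 - k) - r0 `^ (1 - k)) <= c * (r0 `^ (1 - k) * ((1 - k) * s)).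
  by rewrite ler_wnM2l// lerBrDl (le_trans _ hp)// mulrDr mulr1.
have -> : c * (r0 `^ (1 - k) * ((1 - k) * s)) = df r0 * (r0 * s).
  rewrite /c powRB ?(gt_eqF r00) ?implybT// powRr1 ?(ltW r00)//; field.
  by rewrite !gt_eqF// powR_gt0.
by move: JJ; rewrite mulrBr; lra.
Qed.

End curvature_upper_bound.

Lemma derivable_gt0_right (g : R -> R) (c : R) : is_derive (0 : R) 1 g c -> 0 < c -> g 0 = 0 ->
  exists2 e, 0 < e & forall h, 0 < h < e -> 0 < g h.
Proof.
move=> [dg gc] c0 g0.
have : h^-1 *: (g (h *: 1 + 0) - g 0) @[h --> 0^'] --> c by rewrite -gc; exact: dg.
move=> /cvgr_gt/(_ _ c0)/nbhs_ballP[e /= e0 He].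
exists e => // h /andP[h0 he].
have := He h; rewrite /ball/= sub0r normrN gtr0_norm// => /(_ he).
rewrite gt_eqF// => /(_ isT).
by rewrite g0 subr0 addr0 [h *: 1]mulr1 pmulr_rgt0// invr_gt0.
Qed.

(** The bounded quantity is the second derivative at 0 of [f \o q], where [q] is the quadratic. Were
    it positive, the even part [D] would have a derivative [E] positive just right of 0, and [D]
    would exceed [D 0 = 2 * f r0]. *)
Lemma midpoint_concave_second_derivative (r0 v A : R) :
  (forall h, 0 < r0 + v * h + A * h ^+ 2) ->
  (forall h, f (r0 + v * h + A * h ^+ 2) + f (r0 - v * h + A * h ^+ 2) <= 2 * f r0) ->
  ddf r0 * v ^+ 2 + 2 * A * df r0 <= 0.
Proof.
move=> q0 ff; rewrite leNgt; apply/negP => c0.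
pose q h := r0 + v * h + A * h ^+ 2.
have qgt0 h : 0 < q h by exact: q0.
have qN h : q (- h) = r0 - v * h + A * h ^+ 2 by rewrite /q sqrrN mulrN.
have dq (h : R) : is_derive h 1 q (v + 2 * A * h).
  rewrite (_ : q = cst r0 + v *: id + A *: (id ^+ 2)); last first.
    by apply/funext.
  by apply: is_derive_eq; rewrite /GRing.scale /= add0r mulr1 expr1; ring.
pose g h := df (q h) * (v + 2 * A * h).
have dfq (h : R) : is_derive h 1 (f \o q) (g h).
  exact: (is_derive1_comp (is_derive_f (qgt0 h)) (dq h)).
pose E h := g h - g (- h).
have dE : is_derive (0 : R) 1 E (2 * (ddf r0 * v ^+ 2 + 2 * A * df r0)).
  have dg : is_derive (0 : R) 1 g (ddf r0 * v ^+ 2 + 2 * A * df r0).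
    have q00 : q 0 = r0 by rewrite /q mulr0 expr0n mulr0 !addr0.
    rewrite (_ : g = (df \o q) * (cst v + (2 * A) *: id)); last first.
      by apply/funext.
    have dfq0 : is_derive (0 : R) 1 (df \o q) (ddf (q 0) * (v + 2 * A * 0)).
      exact: (is_derive1_comp (is_derive_df (qgt0 0)) (dq 0)).
    apply: is_derive_eq; rewrite /GRing.scale /= q00.
    rewrite -[(_ + _ : R -> R) 0]/(v + 2 * A * 0); ring.
  rewrite (_ : E = g - (g \o -%R)); last by apply/funext.
  have dgN : is_derive (0 : R) 1 (g \o -%R) ((ddf r0 * v ^+ 2 + 2 * A * df r0) * -1).
    by apply: is_derive1_comp; rewrite oppr0.
  by apply: is_derive_eq; ring.
have E0 : E 0 = 0 by rewrite /E oppr0 subrr.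
have c0' : 0 < 2 * (ddf r0 * v ^+ 2 + 2 * A * df r0) by rewrite mulr_gt0.
have [e e0 He] := derivable_gt0_right dE c0' E0.
pose D h := f (q h) + f (q (- h)).
have dD (h : R) : is_derive h 1 D (E h).
  rewrite (_ : D = (f \o q) + ((f \o q) \o -%R)); last by apply/funext.
  have dN : is_derive h 1 ((f \o q) \o -%R) (g (- h) * -1).
    exact: is_derive1_comp.
  by apply: is_derive_eq; rewrite mulrN1.
have e2 : 0 < e / 2 by rewrite divr_gt0.
have [|z zitv DE] := MVT e2 (fun x _ => dD x).
  by apply: derivable_within_continuous => x _; have [] := dD x.
move: zitv; rewrite in_itv /= => /andP[z0 ze].
have : 0 < D (e / 2) - D 0 by rewrite DE subr0 mulr_gt0 ?divr_gt0// He// z0; lra.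
have -> : D 0 = 2 * f r0.
  by rewrite /D /q oppr0 mulr0 expr0n mulr0 !addr0; ring.
by rewrite subr_gt0 ltNge /D qN ff.
Qed.

Lemma nonincreasing_profile (x y : R) : 0 < x -> x <= y -> f y <= f x.
Proof.
move=> x0 xy.
have [z|z /andP[xz zy] E] := @mean_value R f df x y.
  rewrite (min_idPl xy) => /andP[xz _].
  exact: (is_derive_f (lt_le_trans x0 xz)).
rewrite (min_idPl xy) in xz.
rewrite -subr_le0 E mulr_le0_ge0 ?subr_ge0// ltW// df_lt0//.
exact: lt_le_trans xz.
Qed.

(** As [f] is nonincreasing, replacing [g] by the quadratic above it only lowers the values of [f].
    The midpoint inequality thus passes to the quadratic, and [g] need not be differentiable. *)
Lemma curvature_le_of_midpoint_concave (g : R -> R) (k r0 v A : R) : 0 < r0 ->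
  (forall h, 0 < g h <= r0 + v * h + A * h ^+ 2) ->
  (forall h, f (g h) + f (g (- h)) <= 2 * f r0) ->
  k < - r0 * ddf r0 / df r0 -> k * v ^+ 2 <= 2 * A * r0.
Proof.
move=> r00 gq fg.
have q0 h : 0 < r0 + v * h + A * h ^+ 2.
  by have /andP[gh] := gq h; exact: lt_le_trans.
have fq h : f (r0 + v * h + A * h ^+ 2) <= f (g h).
  by have /andP[gh hq] := gq h; exact: nonincreasing_profile.
have D0 : ddf r0 * v ^+ 2 + 2 * A * df r0 <= 0.
  apply: midpoint_concave_second_derivative => // h.
  apply: le_trans (fg h); apply: lerD; first exact: fq.
  by have := fq (- h); rewrite mulrN sqrrN.
have d0 := df_lt0 r00.
rewrite ltr_ndivlMr// => kD.
have h1 : - r0 * ddf r0 * v ^+ 2 <= k * df r0 * v ^+ 2.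
  by rewrite ler_wpM2r ?sqr_ge0// ltW.
have h2 : r0 * (ddf r0 * v ^+ 2 + 2 * A * df r0) <= 0 by rewrite mulr_ge0_le0// ltW.
by rewrite -(ler_nM2l d0); lra.
Qed.

End decreasing_profile.

(** * The profile of an admissible function *)

Section profile.
Context (R : realType) (a : R) (F : R -> \bar R).
Hypothesis a0 : 0 < a.

Let level_itv (r : R) : 0 < r -> a * expR (- r) \in `]0, a[%R.
Proof.
move=> r0; rewrite in_itv /= mulr_gt0 ?expR_gt0//=.
by rewrite gtr_pMr// -expR0 ltr_expR oppr_lt0.
Qed.

(** [fine] loses nothing: admissibility excludes [+oo], and strict monotonicity puts the value above
    [F 0 = -oo]. *)
Lemma admissible_profileE (r : R) : admissible a F -> 0 < r ->
  F (a * expR (- r)) = (profile a F r)%:E.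
Proof.
move=> [Fy _ Fincr F0] /level_itv; rewrite in_itv /= => /andP[l0 la].
rewrite /profile fineK// fin_numE Fy ?in_itv /= ?(ltW l0)// andbT.
by rewrite gt_eqF// -F0 Fincr// in_itv /= ?lexx ?(ltW l0).
Qed.

Hypothesis hC2 : C2 a F.
Hypothesis hF' : forall r, r \in `]0, a[%R -> 0 < (fine \o F)^`()%classic r.

Let is_derive_level (r : R) :
  is_derive r 1 (fun r => a * expR (- r)) (- (a * expR (- r))).
Proof.
have dN : is_derive r 1 (@expR R \o -%R) (expR (- r) * -1) by exact: is_derive1_comp.
rewrite (_ : (fun r => _) = a *: (@expR R \o -%R)); last by apply/funext.
by apply: is_derive_eq; rewrite /GRing.scale /=; ring.
Qed.

Let profile_derive (r : R) : 0 < r -> is_derive r 1 (profile a F)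
  ((fine \o F)^`()%classic (a * expR (- r)) * - (a * expR (- r))).
Proof.
move=> r0; have [d1 _ _] := hC2 (level_itv r0).
rewrite (_ : profile a F = (fine \o F) \o (fun r => a * expR (- r))); last by [].
apply: is_derive1_comp; last exact: is_derive_level.
by rewrite derive1E; exact/derivableP.
Qed.

Lemma is_derive_profile (r : R) : 0 < r ->
  is_derive r 1 (profile a F) ((profile a F)^`()%classic r).
Proof. by move=> /profile_derive[d1 _]; rewrite derive1E; exact/derivableP. Qed.

Lemma profile_derive1_lt0 (r : R) : 0 < r -> (profile a F)^`()%classic r < 0.
Proof.
move=> r0; have [_ d1] := profile_derive r0; rewrite derive1E d1.
by rewrite mulrN oppr_lt0 mulr_gt0 ?hF' ?level_itv// mulr_gt0 ?expR_gt0.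
Qed.

Lemma is_derive_profile1 (r : R) : 0 < r ->
  is_derive r 1 (profile a F)^`()%classic ((profile a F)^`(2)%classic r).
Proof.
move=> r0; have [_ d2 _] := hC2 (level_itv r0).
suff : derivable (profile a F)^`()%classic r 1.
  by move=> /derivableP; rewrite -derive1E.
pose l (r : R) : R := a * expR (- r).
(* The chain rule formula for the first derivative holds only at positive arguments, hence the local
   equality. *)
apply: (@near_eq_derivable _ _ _ (((fine \o F)^`()%classic \o l) * (- l))).
  near=> z; have z0 : 0 < z by near: z; exact: lt_nbhsr.
  by have [_ d1] := profile_derive z0; rewrite derive1E d1.
apply: derivableM.
  have dl : is_derive r 1 l (- (a * expR (- r))) by exact: is_derive_level.
  have d2' : is_derive (l r) 1 (fine \o F)^`()%classic _ := derivableP d2.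
  by have [] := is_derive1_comp d2' dl.
by apply: derivableN; have [] := is_derive_level r.
Unshelve. all: by end_near. Qed.

Lemma kappa_limsup_lt : (kappa_limsup a F < (2^-1)%:E)%E ->
  exists k r1 : R, [/\ 0 < k < 2^-1, 0 <= r1 & forall r, r1 < r -> kappa a F r <= k].
Proof.
rewrite /kappa_limsup limf_esupE => /ereal_inf_lt[_ [V [N [Nr NV]] <-]] supV.
have kV r : N < r -> ((kappa a F r)%:E <= ereal_sup ((fun r => (kappa a F r)%:E) @` V))%E.
  by move=> Nr'; apply: ereal_sup_ubound; exists r => //; exact: NV.
move: supV kV; case: (ereal_sup _) => [s||].
(* [s] and [N] may be negative; the maxima restore [0 < k] and [0 <= r1], and [4^-1] is still below
   [2^-1]. *)
- rewrite lte_fin => s2 kV; exists (Num.max s 4^-1), (Num.max N 0); split.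
  + rewrite lt_max gt_max s2 /= [0 < 4^-1]invr_gt0 ltr0n orbT /= ltf_pV2 ?posrE//.
    by rewrite ltr_nat.
  + by rewrite le_max lexx orbT.
  + move=> r; rewrite gt_max => /andP[/kV + _]; rewrite lee_fin => kr.
    by rewrite le_max kr.
- by rewrite ltNge leey.
(* The supremum is not [-oo], since [V] contains [N + 1]. *)
- by move=> _ /(_ (N + 1)); rewrite ltrDl ltr01 leeNy_eq => /(_ isT).
Qed.

Lemma kappa_limsup_gt : ((2^-1)%:E < kappa_limsup a F)%E ->
  exists2 k : R, 2^-1 < k & forall N : R, exists2 r, N < r & k < kappa a F r.
Proof.
move=> H; have [k k2 kl] : exists2 k : R, 2^-1 < k & (k%:E < kappa_limsup a F)%E.
  move: H; case: (kappa_limsup a F) => [s||].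
  - by rewrite lte_fin => s2; exists ((2^-1 + s) / 2); rewrite ?lte_fin; lra.
  - by move=> _; exists 1; rewrite ?ltry//; lra.
  - by rewrite ltNge leNye.
exists k => // N.
have /ereal_sup_gt[_ [r Nr <-]] : (k%:E < ereal_sup ((fun r => (kappa a F r)%:E) @` [set r | (N < r)%R]))%E.
  apply: (lt_le_trans kl); rewrite /kappa_limsup limf_esupE.
  apply: ereal_inf_lbound; exists [set r | N < r] => //.
  by exists N; split => //; exact: num_real.
by rewrite lte_fin => kr; exists r.
Qed.

End profile.

(** * Numerical inequalities for levels *)

Lemma sub_ln_mul_expR (R : realType) (c u x y : R) : 0 < x -> 0 < y ->
  (x * expR u <= y -> c - ln y <= c - ln x - u) /\
  (y <= x * expR u -> c - ln x - u <= c - ln y).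
Proof.
move=> x0 y0; have lnE : ln (x * expR u) = ln x + u.
  by rewrite lnM ?posrE ?expR_gt0// expRK.
split; rewrite -ler_ln ?posrE ?mulr_gt0 ?expR_gt0// lnE; lra.
Qed.

(** [gauss_tilt] after applying [c - ln], with numbers for its terms: [g] and [g0] are the Gaussian
    integrals at [x] and [x0], [q] the inner product, [S] the squared distance. *)
Lemma ln_tilt (R : realType) (c t g g0 q S K : R) : 0 < t -> 0 < g0 ->
  g0 * expR (- ((S + 2 * q) / (4 * t))) <= g ->
  g <= g0 * expR (- ((S + 2 * q) / (4 * t)) + K * S / (2 * t ^+ 2)) ->
  c - ln g0 + q / (2 * t) + (1 - 2 * K / t) * S / (4 * t) <= c - ln g <=
  c - ln g0 + q / (2 * t) + S / (4 * t).
Proof.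
move=> t0 g00 lo up.
have g_gt0 : 0 < g by rewrite (lt_le_trans _ lo)// mulr_gt0 ?expR_gt0.
have tn0 : t != 0 by rewrite gt_eqF.
have := (sub_ln_mul_expR c _ g00 g_gt0).1 lo.
have := (sub_ln_mul_expR c _ g00 g_gt0).2 up.
have -> : q / (2 * t) = 2 * q / (4 * t) by field.
have -> : (1 - 2 * K / t) * S / (4 * t) = S / (4 * t) - K * S / (2 * t ^+ 2) by field.
by rewrite mulrDl => {}up {}lo; apply/andP; split; lra.
Qed.

(* [r], [p], [S] and [N] stand for [level t z], [dotprod (z - m) (x - z)],
   [|x - z|^2] and [|z - m|^2]. *)
Lemma tilted_quadratic_ge (R : realType) (k e t K r p S N : R) :
  0 < t -> 0 < r -> 0 < e < 1 -> 4 * (k * (1 - k)) <= (1 - e) * (1 - e) ->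
  2 * K / t <= e -> 0 <= S -> p ^+ 2 <= N * S -> (1 - e) * N / (4 * t) <= r ->
  r * (1 + p / (2 * t) / r + (1 - k) * k * (p / (2 * t) / r) ^+ 2) <=
  r + p / (2 * t) + (1 - 2 * K / t) * S / (4 * t).
Proof.
move=> t0 r0 /andP[e0 e1] ke Ke S0 cs Nr.
have e1' : 0 <= 1 - e by rewrite subr_ge0 ltW.
pose w := p ^+ 2 / (4 * t * r).
have w0 : 0 <= w by rewrite divr_ge0 ?sqr_ge0// mulr_ge0 ?(ltW r0)// mulr_ge0 ?(ltW t0).
have -> : r * (1 + p / (2 * t) / r + (1 - k) * k * (p / (2 * t) / r) ^+ 2) =
    r + p / (2 * t) + 4 * (k * (1 - k)) * w / (4 * t).
  by rewrite /w; field; rewrite !gt_eqF.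
rewrite lerD2l ler_pM2r ?invr_gt0 ?mulr_gt0//.
(* Cauchy-Schwarz and the lower bound on [r]. This uses one factor [1 - e] of the bound on
   [4 * (k * (1 - k))]; the other absorbs [2 * K / t]. *)
have we : (1 - e) * w <= S.
  rewrite /w mulrA ler_pdivrMr ?mulr_gt0//.
  rewrite (le_trans (ler_wpM2l e1' cs))// mulrA mulrC ler_wpM2l//.
  by move: Nr; rewrite ler_pdivrMr ?mulr_gt0// (mulrC r).
rewrite (le_trans (ler_wpM2r w0 ke))// -[_ * w]mulrA (le_trans (ler_wpM2l e1' we))//.
by rewrite ler_wpM2r// lerD2l lerN2.
Qed.

Lemma cvg_quadratic (R : realType) (c v A s : R) :
  c + v * (z - s) + A * (z - s) ^+ 2 @[z --> s] --> c.
Proof.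
have cB : z - s @[z --> s] --> (0 : R).
  by rewrite -[0 : R](subrr s); apply: cvgB; [exact: cvg_id|exact: cvg_cst].
have E : c + v * 0 + A * (0 * 0) = c by rewrite !mulr0 !addr0.
rewrite -[X in _ --> X]E; apply: cvgD.
  by apply: cvgD; [exact: cvg_cst|apply: cvgM => //; exact: cvg_cst].
by apply: cvgM; [exact: cvg_cst|exact: cvgM].
Qed.

Lemma half01 (R : realType) : 0 < (2^-1 : R) < 1.
Proof. by apply/andP; split; lra. Qed.

Lemma midpoint_le (R : realType) (x y z : R) :
  (1 - 2^-1) * x + 2^-1 * y <= z -> x + y <= 2 * z.
Proof. lra. Qed.

(* [r <= C + (1 + e) w] and [2 k w <= r], with [w = t v^2] and [1 + e < 2 k],
   bound [r]. *)
Lemma no_large_level (R : realType) (k C t v r : R) : 2^-1 < k -> 0 < t ->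
  r <= C + (1 + (k - 2^-1)) * (t * v ^+ 2) -> k * v ^+ 2 <= 2 * (4 * t)^-1 * r ->
  2 * k * C / (k - 2^-1) < r -> False.
Proof.
move=> k2 t0 up key; rewrite ltr_pdivrMr ?subr_gt0// => rB.
have {}key : 2 * k * (t * v ^+ 2) <= r.
  rewrite -(ler_pM2r (_ : 0 < (2 * t)^-1)) ?invr_gt0 ?mulr_gt0//.
  apply: le_trans (le_trans key _); rewrite le_eqVlt; apply/orP; left; apply/eqP.
    by field; rewrite gt_eqF.
  by field; rewrite gt_eqF.
(* Since [2 * k - (1 + (k - 2^-1)) = k - 2^-1], the next two facts give
   [(k - 2^-1) * r <= 2 * k * C]. *)
have h1 : 2 * k * r <= 2 * k * (C + (1 + (k - 2^-1)) * (t * v ^+ 2)).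
  by rewrite ler_pM2l// mulr_gt0//; lra.
have h2 : (1 + (k - 2^-1)) * (2 * k * (t * v ^+ 2)) <= (1 + (k - 2^-1)) * r.
  by rewrite ler_pM2l//; lra.
move: (t * v ^+ 2) h1 h2 => w; lra.
Qed.

(* Otherwise unification compares values of [gauss] at distinct points by
   unfolding the integral. *)
#[local] Opaque gauss.

(** * The level [ln (a / U)] and its bounds *)

Section level.
Context (R : realType) (n : nat) (a d : R) (phi : 'rV[R]_n -> R) (rho : R).
Local Notation mass := (\int[@lebesgue_rV R n]_y phi y).
Local Notation K := (support_cst n rho).
Hypothesis a0 : 0 < a.
Hypothesis hphi : initial_datum phi.
Hypothesis rho0 : 0 <= rho.
Hypothesis hrho : forall y, phi y != 0 -> forall i, `|y ord0 i| <= rho.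

(** [level] with the Gaussian kernel replaced by 1: the part that depends on [t] alone. *)
Definition level_cst (t : R) : R := ln a + (n%:R / 2 - d) * ln (4 * pi * t) - ln mass.

Definition level (t : R) (x : 'rV[R]_n) : R :=
  ln a + (n%:R / 2 - d) * ln (4 * pi * t) - ln (gauss t phi x).

Lemma support_cst_ge0 : 0 <= K.
Proof. by rewrite /support_cst mulr_ge0 ?sqr_ge0// mulr_ge0. Qed.

Lemma U_level (t : R) (x : 'rV[R]_n) : 0 < t -> U d phi x t = a * expR (- level t x).
Proof.
move=> t0.
have pt0 : 0 < 4 * pi * t by rewrite mulr_gt0// mulr_gt0// pi_gt0.
have g0 : 0 < gauss t phi x by exact: (gauss_gt0 hphi rho0 hrho t0 x).
have -> : U d phi x t = (4 * pi * t) `^ d * ((4 * pi * t) `^ (- (n%:R / 2)) *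
  expR (ln (gauss t phi x))) by rewrite lnK.
have -> : a * expR (- level t x) = expR (ln a) * expR (- level t x) by rewrite lnK.
by rewrite /powR gt_eqF// -!expRD /level; congr expR; ring.
Qed.

Lemma level_bounds (t : R) (x m : 'rV[R]_n) (e : R) : 0 < t -> 0 < e -> (forall i, `|m ord0 i| <= rho) ->
  level_cst t + ((1 - e) * sqnorm (x - m) - (1 + e^-1) * K) / (4 * t) <= level t x <=
  level_cst t + ((1 + e) * sqnorm (x - m) + (1 + e^-1) * K) / (4 * t).
Proof.
move=> t0 e0 mr.
have M0 : 0 < mass by exact: initial_datum_mass_gt0.
have g0 : 0 < gauss t phi x by exact: (gauss_gt0 hphi rho0 hrho t0 x).
have /andP[lo up] := gauss_bounds hphi hrho t0 x e0 mr.
rewrite /level /level_cst; set c := ln a + _.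
rewrite mulrC in lo; rewrite mulrC in up.
have := (sub_ln_mul_expR c _ M0 g0).1 lo; have := (sub_ln_mul_expR c _ M0 g0).2 up.
by rewrite !opprK => -> ->.
Qed.

Lemma level_tilt (t : R) (x0 : 'rV[R]_n) : 0 < t -> exists m : 'rV[R]_n, (forall i, `|m ord0 i| <= rho) /\
  forall x : 'rV[R]_n, level t x0 + dotprod (x0 - m) (x - x0) / (2 * t)
      + (1 - 2 * K / t) * sqnorm (x - x0) / (4 * t) <= level t x <=
    level t x0 + dotprod (x0 - m) (x - x0) / (2 * t) + sqnorm (x - x0) / (4 * t).
Proof.
move=> t0; have [m [mr H]] := gauss_tilt hphi rho0 hrho t0 x0.
exists m; split => // x; have /andP[lo up] := H x.
have g0 z : 0 < gauss t phi z by exact: (gauss_gt0 hphi rho0 hrho t0 z).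
exact: (ln_tilt _ t0 (g0 x0) lo up).
Qed.

(** The condition on [d] makes the coefficient of [ln (4 * pi * t)] positive. *)
Lemma level_cst_unbounded (B : R) : d < n%:R / 2 ->
  exists2 T : R, 0 < T & forall t : R, T <= t -> B < level_cst t.
Proof.
move=> dn; have c0 : 0 < n%:R / 2 - d by rewrite subr_gt0.
have arith (u v w z : R) : u - v + w + 1 <= z -> u < v + z - w by lra.
(* The value of [ln (4 * pi * t)] at which [level_cst t = B + 1]; as [4 * pi >= 1], it is reached
   once [t >= expR b]. *)
pose b := (B - ln a + ln mass + 1) / (n%:R / 2 - d).
exists (expR b) => [|t bt]; first exact: expR_gt0.
have t0 : 0 < t := lt_le_trans (expR_gt0 _) bt.
have bl : b <= ln (4 * pi * t).
  rewrite -ler_expR lnK ?posrE; last by rewrite mulr_gt0// mulr_gt0// pi_gt0.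
  rewrite (le_trans bt)// ler_pMl//.
  by have := @pi_ge2 R; lra.
move: bl; rewrite /level_cst ler_pdivrMr// mulrC.
exact: arith.
Qed.

End level.

#[local] Opaque level level_cst U.

(** * Concavity of the profile composed with the level *)

Section concavity.
Context (R : realType) (n : nat) (a d : R) (F : R -> \bar R).
Hypothesis a0 : 0 < a.
Hypothesis hF : admissible a F.
Hypothesis hC2 : C2 a F.
Hypothesis hF' : forall r, r \in `]0, a[%R -> 0 < (fine \o F)^`()%classic r.
Variables (phi : 'rV[R]_n -> R) (rho : R).
Hypothesis hphi : initial_datum phi.
Hypothesis rho0 : 0 <= rho.
Hypothesis hrho : forall y, phi y != 0 -> forall i, `|y ord0 i| <= rho.
Local Notation K := (support_cst n rho).
Local Notation r_ := (level a d phi).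
Local Notation f := (profile a F).
Local Notation df := ((profile a F)^`()%classic).

(** The last hypothesis puts every level above [r1], where the curvature bound holds. Then
    [profile_tangent] applies at [r_ t z], its quadratic premise coming from [level_tilt] and
    [tilted_quadratic_ge]. *)
Lemma level_supporting_hyperplane (t k r1 e : R) (z : 'rV[R]_n) :
  0 < t -> 0 < k < 2^-1 -> 0 <= r1 -> (forall r, r1 < r -> kappa a F r <= k) ->
  0 < e < 1 -> 4 * (k * (1 - k)) <= (1 - e) * (1 - e) -> 2 * K / t <= e ->
  r1 + (1 + e^-1) * K / (4 * t) < level_cst a d phi t ->
  exists v, forall x, f (r_ t x) <= f (r_ t z) + dotprod v (x - z).
Proof.
move=> t0 k01 r10 kap e01 ke Ke cst; have /andP[e0 e1] := e01.
have t4 : 0 < 4 * t by rewrite mulr_gt0.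
have r_lb (x m : 'rV[R]_n) : (forall i, `|m ord0 i| <= rho) ->
    r1 < r_ t x /\ (1 - e) * sqnorm (x - m) / (4 * t) < r_ t x.
  move=> mr; have /andP[lo _] := level_bounds a d hphi rho0 hrho x t0 e0 mr.
  have S0 : 0 <= (1 - e) * sqnorm (x - m) / (4 * t).
    by rewrite divr_ge0 ?(ltW t4)// mulr_ge0 ?sqnorm_ge0// subr_ge0 ltW.
  by move: lo; rewrite mulrBl; split; lra.
have [m [mr H]] := level_tilt a d hphi rho0 hrho z t0.
exists ((df (r_ t z) / (2 * t)) *: (z - m)) => x.
have [r1z rz] := r_lb z m mr; have [r1x _] := r_lb x m mr.
have /andP[lo _] := H x.
have rz0 : 0 < r_ t z := le_lt_trans r10 r1z.
pose s := dotprod (z - m) (x - z) / (2 * t) / r_ t z.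
have -> : dotprod ((df (r_ t z) / (2 * t)) *: (z - m)) (x - z) = df (r_ t z) * (r_ t z * s).
  have -> : r_ t z * s = dotprod (z - m) (x - z) / (2 * t) by rewrite mulrC divfK ?gt_eqF.
  rewrite /dotprod mulr_suml mulr_sumr.
  by apply: eq_bigr => i _; rewrite !mxE; ring.
apply: (profile_tangent (is_derive_profile a0 hC2) (is_derive_profile1 a0 hC2)
  (profile_derive1_lt0 a0 hC2 hF') k01 r10 _ r1z r1x).
  by move=> r /kap.
apply: le_trans lo.
exact: (tilted_quadratic_ge t0 rz0 e01 ke Ke (sqnorm_ge0 _) (dotprod_sqr_le _ _)
  (ltW rz)).
Qed.

(** Positivity of [r] keeps [u] inside []0, a[], where [F] is finite and the extended-real
    inequality is a real one. *)
Lemma F_concave_profileP (u r : 'rV[R]_n -> R) :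
  (forall x, u x = a * expR (- r x)) -> (forall x, 0 < r x) ->
  F_concave a F u <-> forall x y mu, 0 < mu < 1 ->
    (1 - mu) * f (r x) + mu * f (r y) <= f (r ((1 - mu) *: x + mu *: y)).
Proof.
move=> ur r0.
have FE w : F (u w) = (f (r w))%:E by rewrite ur; exact: admissible_profileE.
split=> [[_ H] x y mu mu01|H].
  by have := H x y mu mu01; rewrite !FE -!EFinM -EFinD lee_fin.
split=> [x|x y mu mu01]; last first.
  by rewrite !FE -!EFinM -EFinD lee_fin; exact: H.
rewrite ur in_itv /= mulr_ge0 ?expR_ge0 ?(ltW a0)//= gtr_pMr//.
by rewrite -expR0 ltr_expR oppr_lt0.
Qed.

(** Average the supporting inequality at the convex combination [z]: the linear terms cancel. *)
Lemma concave_of_supporting_hyperplanes (g : 'rV[R]_n -> R) :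
  (forall z, exists v, forall x, g x <= g z + dotprod v (x - z)) ->
  forall x y mu, 0 < mu < 1 ->
    (1 - mu) * g x + mu * g y <= g ((1 - mu) *: x + mu *: y).
Proof.
move=> H x y mu /andP[mu0 mu1]; set z := (1 - mu) *: x + mu *: y; have [v Hv] := H z.
have w0 : 0 <= 1 - mu by rewrite subr_ge0 ltW.
have hx := ler_wpM2l w0 (Hv x); have hy := ler_wpM2l (ltW mu0) (Hv y).
have E : (1 - mu) * dotprod v (x - z) + mu * dotprod v (y - z) = 0.
  rewrite -!dotprodZr -dotprodDr (_ : _ + _ = 0).
    by apply: big1 => i _; rewrite mxE mulr0.
  by apply/rowP => i; rewrite /z !mxE; ring.
have -> : g z = (1 - mu) * (g z + dotprod v (x - z)) + mu * (g z + dotprod v (y - z)).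
  by rewrite !mulrDr addrACA E addr0 -mulrDl subrK mul1r.
exact: lerD.
Qed.

Lemma eventually_F_concave_U : d < n%:R / 2 -> (kappa_limsup a F < (2^-1)%:E)%E ->
  eventually_F_concave a F (U d phi).
Proof.
move=> dn /kappa_limsup_lt[k [r1 [k01 r10 kap]]].
have /andP[k0 k2] := k01.
(* Chosen so that [4 * (k * (1 - k)) = 1 - 2 * e <= (1 - e) ^+ 2]; it is positive because
   [k < 2^-1]. *)
pose e := (1 - 4 * (k * (1 - k))) / 2.
have q1 : 4 * (k * (1 - k)) < 1.
  have -> : 4 * (k * (1 - k)) = 1 - (1 - 2 * k) ^+ 2 by ring.
  by rewrite gtrDl oppr_lt0 exprn_gt0//; lra.
have q0 : 0 < k * (1 - k) by rewrite mulr_gt0//; lra.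
have e01 : 0 < e < 1 by rewrite /e; apply/andP; split; lra.
have /andP[e0 e1] := e01.
have ke : 4 * (k * (1 - k)) <= (1 - e) * (1 - e).
  have -> : 4 * (k * (1 - k)) = 1 - 2 * e by rewrite /e; field.
  by have := sqr_ge0 e; rewrite expr2; lra.
have K0 := support_cst_ge0 n rho.
have [T T0 HT] := @level_cst_unbounded R n a d phi (r1 + (1 + e^-1) * K) dn.
(* [T] makes [level_cst] large, [1] allows the division by [4 * t] in [cst], and [2 * K / e] gives
   [2 * K / t <= e]. *)
exists (Num.max T (Num.max 1 (2 * K / e))) => [|t].
  by rewrite lt_max T0.
rewrite !ge_max => /andP[/HT cT /andP[t1 tK]].
have t0 : 0 < t := lt_le_trans ltr01 t1.
have cst : r1 + (1 + e^-1) * K / (4 * t) < level_cst a d phi t.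
  apply: le_lt_trans cT; rewrite lerD2l ler_pdivrMr ?mulr_gt0// ler_peMr//.
    by rewrite mulr_ge0// addr_ge0// invr_ge0 ltW.
  lra.
have Ke : 2 * K / t <= e by rewrite ler_pdivrMr// (mulrC e) -ler_pdivrMr.
have r0 x : 0 < r_ t x.
  have m0 : forall i, `|(0 : 'rV[R]_n) ord0 i| <= rho by move=> i; rewrite mxE normr0.
  have /andP[lo _] := level_bounds a d hphi rho0 hrho x t0 e0 m0.
  rewrite (le_lt_trans r10)// (lt_le_trans _ lo)//.
  have : 0 <= (1 - e) * sqnorm (x - 0) / (4 * t).
    by rewrite divr_ge0 ?mulr_ge0 ?(ltW t0) ?sqnorm_ge0// subr_ge0 ltW.
  by rewrite mulrBl; lra.
have UE x := U_level d a0 hphi rho0 hrho x t0.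
apply/(F_concave_profileP UE r0)/concave_of_supporting_hyperplanes => z.
exact: (level_supporting_hyperplane z t0 k01 r10 kap e01 ke Ke cst).
Qed.

(** * Failure of concavity along a coordinate axis *)

Section nonconcavity.
Variables (i0 : 'I_n) (t : R).
Hypothesis t0 : 0 < t.
Local Notation e1 := (delta_mx ord0 i0 : 'rV[R]_n).

Lemma dotprod_axis (x : 'rV[R]_n) (s : R) : dotprod x (s *: e1) = s * x ord0 i0.
Proof.
rewrite dotprodZr; congr (_ * _); rewrite /dotprod (bigD1 i0)//= !mxE !eqxx mulr1.
by rewrite big1 ?addr0// => i /negPf ii0; rewrite !mxE ii0 andbF mulr0.
Qed.

Lemma sqnorm_axis (s : R) : sqnorm (s *: e1) = s ^+ 2.
Proof.
rewrite (_ : sqnorm _ = dotprod (s *: e1) (s *: e1)); last first.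
  by apply: eq_bigr => i _; rewrite expr2.
by rewrite dotprod_axis !mxE !eqxx mulr1 expr2.
Qed.

(** With [v = (s - m ord0 i0) / (2 * t)], the term [t * v ^+ 2] is the contribution of the axis to
    the level; the other coordinates of [m] add at most [K]. *)
Lemma level_axis_tilt (e s : R) : 0 < e -> exists v : R,
  (forall h, r_ t (s *: e1) + v * h + (1 - 2 * K / t) / (4 * t) * h ^+ 2
    <= r_ t ((s + h) *: e1) <= r_ t (s *: e1) + v * h + (4 * t)^-1 * h ^+ 2) /\
  r_ t (s *: e1) <= level_cst a d phi t +
    ((1 + e) * K + (1 + e^-1) * K) / (4 * t) + (1 + e) * (t * v ^+ 2).
Proof.
move=> e0; have [m [mr H]] := level_tilt a d hphi rho0 hrho (s *: e1) t0.
have ne : t != 0 by rewrite gt_eqF.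
exists ((s - m ord0 i0) / (2 * t)); split=> [h|].
  have := H ((s + h) *: e1).
  have -> : (s + h) *: e1 - s *: e1 = h *: e1 by rewrite -scalerBl addrC addKr.
  rewrite dotprod_axis sqnorm_axis !mxE !eqxx mulr1 => /andP[lo up].
  apply/andP; split; first (apply: le_trans lo); last (apply: (le_trans up));
    by rewrite le_eqVlt; apply/orP; left; apply/eqP; field.
have /andP[_ up] := level_bounds a d hphi rho0 hrho (s *: e1) t0 e0 mr.
apply: (le_trans up); rewrite -[leRHS]addrA lerD2l.
have le_sq : sqnorm (s *: e1 - m) <= (s - m ord0 i0) ^+ 2 + K.
  have -> : sqnorm (s *: e1 - m) = s ^+ 2 - 2 * (s * m ord0 i0) + sqnorm m.
    rewrite addrC sqnormD sqnorm_axis dotprod_axis sqnormN mxE; ring.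
  have mK : sqnorm m <= K.
    rewrite -(subr0 m); apply: sqnormB_support => // i.
    by rewrite mxE normr0.
  by have := sqr_ge0 (m ord0 i0); rewrite sqrrB; lra.
rewrite ler_pdivrMr ?mulr_gt0//.
have -> : (((1 + e) * K + (1 + e^-1) * K) / (4 * t) +
     (1 + e) * (t * ((s - m ord0 i0) / (2 * t)) ^+ 2)) * (4 * t) =
  (1 + e) * ((s - m ord0 i0) ^+ 2 + K) + (1 + e^-1) * K.
  by field; rewrite !gt_eqF.
by rewrite lerD2r ler_pM2l// addr_gt0.
Qed.

(** Squeeze between the two parabolas of [level_axis_tilt], which agree at [s]. *)
Lemma level_axis_continuous : continuous (fun s : R => r_ t (s *: e1)).
Proof.
move=> s; have [v [H _]] := @level_axis_tilt 1 s ltr01.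
pose c := r_ t (s *: e1).
apply: (@squeeze_cvgr _ _ _ _ (fun z => c + v * (z - s) + (1 - 2 * K / t) / (4 * t) * (z - s) ^+ 2)
  (fun z => c + v * (z - s) + (4 * t)^-1 * (z - s) ^+ 2)).
- by apply: nearW => z; have := H (z - s); rewrite subrKC.
- exact: cvg_quadratic.
- exact: cvg_quadratic.
Qed.

Lemma level_axis_onto (rr : R) : r_ t 0 <= rr -> exists s : R, r_ t (s *: e1) = rr.
Proof.
move=> r0r.
have m0 : forall i, `|(0 : 'rV[R]_n) ord0 i| <= rho by move=> i; rewrite mxE normr0.
have h2 : 0 < 2^-1 :> R by rewrite invr_gt0.
pose C := level_cst a d phi t - (1 + 2^-1^-1) * K / (4 * t).
have lb s : C + s ^+ 2 / (8 * t) <= r_ t (s *: e1).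
  have /andP[lo _] := level_bounds a d hphi rho0 hrho (s *: e1) t0 h2 m0.
  apply: le_trans lo; rewrite subr0 sqnorm_axis /C le_eqVlt.
  by apply/orP; left; apply/eqP; field; rewrite gt_eqF.
(* As [S >= 1], one has [S ^+ 2 >= S >= 8 * t * (rr - C)], so the level at [S] exceeds [rr] and the
   intermediate value theorem applies. *)
pose S := 1 + 8 * t * `|rr - C|.
have S1 : 1 <= S by rewrite lerDl mulr_ge0// mulr_ge0// ltW.
have rS : rr <= r_ t (S *: e1).
  apply: le_trans (lb S); rewrite -lerBlDl ler_pdivlMr ?mulr_gt0//.
  apply: (@le_trans _ _ S); last by rewrite expr2 ler_peMl// (le_trans ler01).
  have : (rr - C) * (8 * t) <= `|rr - C| * (8 * t).
    by rewrite ler_pM2r ?mulr_gt0// ler_norm.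
  by rewrite /S; lra.
have ivt (g : R -> R) : continuous g -> g 0 <= rr -> rr <= g S -> exists s, g s = rr.
  move=> cg g0 gS; have [|||s _ <-] := @IVT R g 0 S rr; last by exists s.
  - exact: le_trans S1.
  - exact/continuous_subspaceT.
  - by rewrite ge_min g0 le_max gS orbT.
have r00 : r_ t (0 *: e1) <= rr by rewrite scale0r; exact: r0r.
exact: (ivt _ level_axis_continuous r00 rS).
Qed.

(** Concavity fails at each single time: [t] stays fixed while the level [rr] is taken far out on
    the axis. *)
Lemma not_F_concave_U : ((2^-1)%:E < kappa_limsup a F)%E ->
  ~ F_concave a F (fun x => U d phi x t).
Proof.
move=> /kappa_limsup_gt[k k2 kfreq] Uc.
have UE x := U_level d a0 hphi rho0 hrho x t0.
(* Concavity includes [U < a], which is positivity of the level. *)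
have r0 x : 0 < r_ t x.
  have := Uc.1 x; rewrite UE in_itv /= => /andP[_].
  by rewrite gtr_pMr// -expR0 ltr_expR oppr_lt0.
have Fc := (F_concave_profileP UE r0).1 Uc.
have e0 : 0 < k - 2^-1 by rewrite subr_gt0.
set e := k - 2^-1 in e0.
pose C := level_cst a d phi t + ((1 + e) * K + (1 + e^-1) * K) / (4 * t).
(* The first threshold makes [rr] a level on the axis, the second contradicts [no_large_level]. *)
have [rr] := kfreq (Num.max (r_ t 0) (2 * k * C / e)).
rewrite gt_max => /andP[r0r rB] krr.
have [s rs] := level_axis_onto (ltW r0r).
have [v [H up]] := level_axis_tilt s e0.
have rr0 : 0 < rr by rewrite -rs.
rewrite rs -/C in up.
have gq h : 0 < r_ t ((s + h) *: e1) <= rr + v * h + (4 * t)^-1 * h ^+ 2.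
  by rewrite r0; have /andP[_] := H h; rewrite rs.
have fg h : f (r_ t ((s + h) *: e1)) + f (r_ t ((s - h) *: e1)) <= 2 * f rr.
  have := Fc ((s + h) *: e1) ((s - h) *: e1) _ (half01 R).
  have -> : (1 - 2^-1) *: ((s + h) *: e1) + 2^-1 *: ((s - h) *: e1) = s *: e1.
    by rewrite !scalerA -scalerDl; congr (_ *: _); field.
  by rewrite rs; exact: midpoint_le.
have key := curvature_le_of_midpoint_concave (is_derive_profile a0 hC2)
  (is_derive_profile1 a0 hC2) (profile_derive1_lt0 a0 hC2 hF') rr0 gq fg krr.
exact: (no_large_level k2 t0 up key rB).
Qed.

End nonconcavity.
End concavity.

Theorem theorem1p2 (R : realType) (n : nat) (hn : (1 <= n)%N)
    (d : R) (hd : d < n%:R / 2) (a : R) (ha : 0 < a)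
    (F : R -> \bar R) (hF : admissible a F) (hC2 : C2 a F)
    (hF' : forall r, r \in `]0, a[%R -> 0 < (fine \o F)^`()%classic r) :
  ((kappa_limsup a F < (2^-1)%:E)%E ->
     forall phi : 'rV[R]_n -> R, initial_datum phi ->
       eventually_F_concave a F (U d phi)) /\
  (((2^-1)%:E < kappa_limsup a F)%E ->
     forall phi : 'rV[R]_n -> R, initial_datum phi ->
       ~ eventually_F_concave a F (U d phi)).
Proof.
split=> [kap phi hphi|kap phi hphi [T T0 HT]].
  have [rho rho0 hrho] := initial_datum_support hphi.
  exact: (eventually_F_concave_U ha hF hC2 hF' hphi rho0 hrho hd kap).
have [rho rho0 hrho] := initial_datum_support hphi.
(* [hn] provides the coordinate axis, and the time [T] alone yields the contradiction. *)
exact: (not_F_concave_U ha hF hC2 hF' hphi rho0 hrho (Ordinal hn) T0 kap (HT T (lexx T))).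
Qed.
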